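(* In the Ising mixed $p$-spin model with parameters $(\xi,h)$, let $Q^{Met,SRW}$ be the Metropolis transition matrix for the Gibbs measure $\pi_N$ with base chain the simple random walk on $\Sigma_N$. Almost surely, for all $N$, $Q^{Met,SRW}$ is $P_{SRW}$-coercive. In particular, writing $\lambda_1$ for the spectral gap of $I-Q^{Met,SRW}$, there is a constant $c>0$ such that $$\limsup_{N\to\infty}\frac1N\log\mathbb P\Big(\frac1N\log\lambda_1<-c\Big)<0 .$$
   Context: **Model.** For $N\ge1$ let $\Sigma_N=\{-1,1\}^N$ and let $d\sigma$ be the uniform probability measure on $\Sigma_N$. Let $\xi(t)=\sum_{p\ge1}\beta_p^2t^p$ with $\xi(1+\epsilon)<\infty$ for some $\epsilon>0$, and $h\ge0$. $H_N$ is the Gaussian process on $\Sigma_N$ with $\mathbb{E}H_N(\sigma)=h\sum_i\sigma_i$ and $\mathrm{Cov}(H_N(\sigma^1),H_N(\sigma^2))=N\xi\big(\frac1N\sum_i\sigma^1_i\sigma^2_i\big)$. The Gibbs measure is $\pi_N(d\sigma)=e^{-H_N(\sigma)}d\sigma/Z_N$. **Chains.** $P_{SRW}(\sigma^1,\sigma^2)=\frac1N$ if $\sigma^1,\sigma^2$ differ in exactly one coordinate, and $0$ otherwise. For $\sigma^1\ne\sigma^2$, $Q^{Met,SRW}(\sigma^1,\sigma^2)=P_{SRW}(\sigma^1,\sigma^2)\big(1\wedge\frac{\pi_N(\sigma^2)}{\pi_N(\sigma^1)}\big)$, and $Q^{Met,SRW}(\sigma^1,\sigma^1)=1-\sum_{\sigma\ne\sigma^1}Q^{Met,SRW}(\sigma^1,\sigma)$.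 **Spectral gap.** $\lambda_1=\min_{\mathrm{Var}_{\pi_N}(f)\ne0}\langle (I-Q)f,f\rangle_{L^2(\pi_N)}/\mathrm{Var}_{\pi_N}(f)$ with $Q=Q^{Met,SRW}$. **Coercivity.** $Q$ is $P$-coercive if there is a constant $A>0$ (which may depend on $N$ and on $H_N$) with $A\,P(\sigma^1,\sigma^2)\le Q(\sigma^1,\sigma^2)$ for all $\sigma^1,\sigma^2\in\Sigma_N$. *)

(* Defs.v *)
From HB Require Import structures.
From mathcomp Require Import all_boot all_order all_algebra.
From mathcomp Require Import all_classical all_reals all_analysis.

Set Implicit Arguments.
Unset Strict Implicit.
Unset Printing Implicit Defensive.

Import Order.TTheory GRing.Theory Num.Theory.
Import numFieldNormedType.Exports.

Local Open Scope classical_set_scope.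
Local Open Scope ring_scope.

(* {-1,1}^N, with [true] encoding +1 and [false] encoding -1. *)
Definition cube (N : nat) : finType := {ffun 'I_N -> bool}.

Definition spin (R : realType) (N : nat) (s : cube N) (i : 'I_N) : R :=
  if s i then 1 else -1.

Definition overlap (R : realType) (N : nat) (s t : cube N) : R :=
  N%:R^-1 * \sum_(i < N) spin R s i * spin R t i.

(* Only the values [beta p] with [1 <= p] are used; the finiteness condition
   required of [xi] is [xi_finite_beyond1]. *)
Definition xi (R : realType) (beta : nat -> R) (t : R) : R :=
  \big[+%R/0]_(1 <= p <oo) (beta p ^+ 2 * t ^+ p).

Definition xi_finite_beyond1 (R : realType) (beta : nat -> R) : Prop :=
  exists2 e : R, 0 < e &
    (\sum_(1 <= p <oo) (beta p ^+ 2 * (1 + e) ^+ p)%:E < +oo)%E.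

Section Gaussian.
Context {d : measure_display} {T : measurableType d} {R : realType}.
Variable P : probability T R.

(* The library's [normal_prob m 0] is not a point mass, so the degenerate
   normal law is spelled out. *)
Definition normal_law (m s : R) (B : set R) : \bar R :=
  if s == 0 then \d_m B else normal_prob m s B.

Definition gaussian_variable (X : T -> R) : Prop :=
  exists m s : R, forall B : set (measurableTypeR R),
    measurable B -> pushforward P X B = normal_law m s B.

Definition gaussian_process (S : finType) (X : S -> {RV P >-> R}) : Prop :=
  forall a : S -> R, gaussian_variable (fun w => \sum_(s : S) a s * X s w).

Definition mixed_pspin (beta : nat -> R) (h : R) (N : nat)
    (H : cube N -> {RV P >-> R}) : Prop :=
  [/\ gaussian_process H,
      forall s, ('E_P[H s] = (h * \sum_(i < N) spin R s i)%:E)%E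
    & forall s t,
        covariance P (H s) (H t) = (N%:R * xi beta (overlap R s t))%:E].

End Gaussian.

Section Chains.
Context {R : realType} {N : nat}.

Definition uniform_cube (s : cube N) : R := #|cube N|%:R^-1.

Definition partition_function (H : cube N -> R) : R :=
  \sum_(s : cube N) expR (- H s) * uniform_cube s.

Definition gibbs (H : cube N -> R) (s : cube N) : R :=
  expR (- H s) * uniform_cube s / partition_function H.

Definition P_SRW (s t : cube N) : R :=
  if #|[set i | s i != t i]%SET| == 1%N then N%:R^-1 else 0.

Definition metropolis (pi : cube N -> R) (B : cube N -> cube N -> R)
    (s t : cube N) : R :=
  let off s t := B s t * Num.min 1 (pi t / pi s) in
  if s == t then 1 - \sum_(u | u != s) off s u else off s t.

Definition coercive (B Q : cube N -> cube N -> R) : Prop :=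
  exists2 A : R, 0 < A & forall s t, A * B s t <= Q s t.

Definition mean (pi : cube N -> R) (f : cube N -> R) : R :=
  \sum_s pi s * f s.

Definition var (pi : cube N -> R) (f : cube N -> R) : R :=
  mean pi (fun s => (f s - mean pi f) ^+ 2).

(* <(I - Q) f, f> in L^2(pi) *)
Definition dirichlet (pi : cube N -> R) (Q : cube N -> cube N -> R)
    (f : cube N -> R) : R :=
  mean pi (fun s => (f s - \sum_t Q s t * f t) * f s).

(* The space of [f] is finite-dimensional, so the minimum of the Rayleigh
   quotient is attained and equals this infimum. *)
Definition spectral_gap (pi : cube N -> R) (Q : cube N -> cube N -> R) : R :=
  inf [set dirichlet pi Q f / var pi f | f in [set f | var pi f != 0]].

Definition Q_Met_SRW (H : cube N -> R) : cube N -> cube N -> R :=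
  metropolis (gibbs H) P_SRW.

Definition lambda1 (H : cube N -> R) : R :=
  spectral_gap (gibbs H) (Q_Met_SRW H).

End Chains.

(* Main.v *)
(* If |H| <= M N on the whole cube then every Gibbs weight is at least
   exp(- 2 M N) / 2^N, and comparing f along paths of at most N single-spin
   flips bounds Var(f) by the Dirichlet form up to a factor exponential in N;
   so lambda1 >= exp(- c N) deterministically on that event. Each H(sigma) is
   Gaussian with mean and variance O(N), so a Gaussian tail bound and a union
   bound over the 2^N configurations give that event probability at least
   1 - exp(- N) once M is large. The parameters of the law of H(sigma) are not
   computed from its moments: Chebyshev's inequality already confines them.
   [P] is only controlled on measurable sets, so {lambda1 < a} is shown to be
   measurable, as a countable union over rational test functions. *)

Require Import Defs.
From HB Require Import structures.
From mathcomp Require Import all_boot all_order all_algebra.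
From mathcomp Require Import all_classical all_reals all_analysis.
From mathcomp Require Import measurable_realfun ring lra.

Set Implicit Arguments.
Unset Strict Implicit.
Unset Printing Implicit Defensive.

Import Order.TTheory GRing.Theory Num.Theory.
Import numFieldNormedType.Exports.

Local Open Scope classical_set_scope.
Local Open Scope ring_scope.

(** * Hamming distance and single-spin flips on the cube *)

Section Hypercube.
Context {N : nat}.
Implicit Types s t : cube N.

Definition hamming s t := #|[set i | s i != t i]%SET|.

Definition flip s (i : 'I_N) : cube N := [ffun j => (j == i) (+) s j].

Lemma hamming_sym s t : hamming s t = hamming t s.
Proof. by rewrite /hamming; apply: eq_card => i; rewrite !inE eq_sym. Qed.

Lemma hamming_le s t : (hamming s t <= N)%N.
Proof. by rewrite -[leqRHS]card_ord max_card. Qed.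

Lemma hamming_eq0 s t : (hamming s t == 0%N) = (s == t).
Proof.
rewrite cards_eq0; apply/eqP/eqP => [st|->]; last first.
  by apply/setP => i; rewrite !inE eqxx.
by apply/ffunP => i; move/setP/(_ i): st; rewrite !inE => /negbFE/eqP.
Qed.

Lemma flip_diff s i : [set j | s j != flip s i j]%SET = [set i]%SET.
Proof.
by apply/setP => j; rewrite !inE ffunE; case: (j == i) => //=; case: (s j).
Qed.

Lemma hamming_flip s i : hamming s (flip s i) = 1%N.
Proof. by rewrite /hamming flip_diff cards1. Qed.

Lemma hamming1P s t : hamming s t = 1%N -> exists i, t = flip s i.
Proof.
move=> /eqP/cards1P[i /setP st]; exists i; apply/ffunP => j; rewrite ffunE.
by have := st j; rewrite !inE => <-; case: (s j) (t j) => [] [].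
Qed.

Lemma card_hamming1 s : (#|[set t | hamming s t == 1%N]%SET| <= N)%N.
Proof.
rewrite -[leqRHS]card_ord -cardsT.
apply: leq_trans (leq_imset_card (flip s) _); apply: subset_leq_card.
apply/fintype.subsetP => t; rewrite inE => /eqP/hamming1P[i ->].
by apply: imset_f.
Qed.

(** Flipping one coordinate where [s] and [t] disagree lowers their distance by exactly one, so
    induction on the distance and the triangle inequality build the path. *)
Lemma hamming_lipschitz (R : realType) (f : cube N -> R) (D : R) :
  (forall s t, hamming s t = 1%N -> `|f s - f t| <= D) ->
  forall s t, `|f s - f t| <= (hamming s t)%:R * D.
Proof.
move=> fD s t; move: {2}(hamming s t) (erefl (hamming s t)) => k.
elim: k s => [|k IH] s st.
  rewrite st mul0r; move/eqP: st; rewrite hamming_eq0 => /eqP ->.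
  by rewrite subrr normr0.
have /card_gt0P[i] : (0 < hamming s t)%N by rewrite st.
rewrite inE => sti.
have ht : hamming (flip s i) t = k.
  have := st; rewrite /hamming (cardsD1 i) inE sti add1n => -[<-].
  apply: eq_card => j; rewrite !inE ffunE; case: (eqVneq j i) => [->|//].
  by move: sti; case: (s i) (t i) => [] [].
rewrite st -nat1r mulrDl mul1r -(subrKA (f (flip s i))).
apply: le_trans (ler_normD _ _) _; apply: lerD.
  by apply: fD; exact: hamming_flip.
by rewrite -ht; exact: IH.
Qed.

End Hypercube.

(** * Dirichlet form and variance of a reversible chain *)

Section Reversible.
Context {R : realType} {N : nat}.
Implicit Types (pi f : cube N -> R) (B Q : cube N -> cube N -> R).

(** Unit row sums turn [f s - (Q f) s] into an average of [f s - f t]. Averaging with the copy in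
    which [s] and [t] are swapped, equal by detailed balance, produces the square. *)
Lemma dirichlet_sym pi Q f :
  (forall s, \sum_t Q s t = 1) ->
  (forall s t, pi s * Q s t = pi t * Q t s) ->
  2 * dirichlet pi Q f = \sum_s \sum_t pi s * Q s t * (f s - f t) ^+ 2.
Proof.
move=> Q1 piQ.
have E : dirichlet pi Q f = \sum_s \sum_t pi s * Q s t * ((f s - f t) * f s).
  apply: eq_bigr => s _.
  rewrite -[X in X - _]mul1r -(Q1 s) mulr_suml -sumrB mulr_suml mulr_sumr.
  by apply: eq_bigr => t _; ring.
rewrite mulr_natl mulr2n {2}E exchange_big/= E -big_split/=.
apply: eq_bigr => s _; rewrite -big_split/=; apply: eq_bigr => t _.
by rewrite (piQ t s); ring.
Qed.

Lemma var_ge0 pi f : (forall s, 0 <= pi s) -> 0 <= var pi f.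
Proof. by move=> p0; apply: sumr_ge0 => s _; rewrite mulr_ge0 ?sqr_ge0. Qed.

(** The deviation [f s - mean pi f] is the [pi]-average over [t] of [f s - f t], so it is itself at
    most [K] in absolute value. *)
Lemma var_le_osc pi f (K : R) :
  (forall s, 0 <= pi s) -> \sum_s pi s = 1 ->
  (forall s t, `|f s - f t| <= K) -> var pi f <= K ^+ 2.
Proof.
move=> p0 p1 fK; rewrite -[leRHS]mul1r -p1 mulr_suml.
apply: ler_sum => s _; apply: ler_wpM2l => //.
rewrite -real_normK ?num_real// lerXn2r ?nnegrE//.
  by rewrite (le_trans _ (fK s s)).
rewrite -[f s]mul1r -p1 mulr_suml -sumrB.
apply: le_trans (ler_norm_sum _ _ _) _; rewrite -[K]mul1r -p1 mulr_suml.
by apply: ler_sum => t _; rewrite -mulrBr normrM ger0_norm// ler_wpM2l.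
Qed.

Lemma var_neq0 pi f s t : (forall s, 0 < pi s) -> f s != f t ->
  var pi f != 0.
Proof.
move=> p0; apply: contra_neq => /eqP; rewrite psumr_eq0; last first.
  by move=> u _; rewrite mulr_ge0 ?sqr_ge0// ltW.
move=> /allP z; suff fE u : f u = mean pi f by rewrite !fE.
have := z u (mem_index_enum u).
by rewrite mulf_eq0 gt_eqF//= sqrf_eq0 subr_eq0 => /eqP.
Qed.

End Reversible.

(** * Metropolis chain: reversibility, coercivity and a Poincaré inequality *)

Section Metropolis.
Context {R : realType} {N : nat}.
Variable pi : cube N -> R.
Hypothesis pi_gt0 : forall s, 0 < pi s.
Local Notation Q := (metropolis pi P_SRW).

Lemma P_SRWE (s t : cube N) :
  P_SRW s t = (if hamming s t == 1%N then N%:R^-1 else 0) :> R.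
Proof. by []. Qed.

Lemma P_SRW_ge0 (s t : cube N) : 0 <= P_SRW s t :> R.
Proof. by rewrite P_SRWE; case: ifP. Qed.

Lemma P_SRW_diag (s : cube N) : P_SRW s s = 0 :> R.
Proof.
by rewrite P_SRWE (_ : hamming s s = 0%N)//; apply/eqP; rewrite hamming_eq0.
Qed.

(** An inequality suffices to keep the diagonal of the Metropolis matrix nonnegative, and it covers
    [N = 0], where the sum is 0 because [0^-1 = 0]. *)
Lemma sum_P_SRW_le1 (s : cube N) : \sum_t P_SRW s t <= 1 :> R.
Proof.
under eq_bigr do rewrite P_SRWE.
rewrite -big_mkcond/= sumr_const.
have [N0|N0] := posnP N.
  by rewrite [X in X *+ _](_ : _ = 0) ?mul0rn// N0 invr0.
rewrite -[_ *+ #|_|]mulr_natr ler_pdivrMl ?ltr0n// mulr1 ler_nat.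
apply: leq_trans (card_hamming1 s); apply: subset_leq_card.
by apply/fintype.subsetP => t; rewrite !inE.
Qed.

(** The right-hand side is symmetric in [s] and [t], which gives detailed balance; a lower bound on
    [pi] bounds it from below, which gives coercivity and the spectral gap. *)
Lemma metropolis_offdiag s t : s != t ->
  pi s * Q s t = P_SRW s t * Num.min (pi s) (pi t).
Proof.
move=> /negPf st; rewrite /metropolis st mulrCA minr_pMr ?ltW// mulr1.
by rewrite mulrCA divff ?mulr1// gt_eqF.
Qed.

Lemma metropolis_reversible s t : pi s * Q s t = pi t * Q t s.
Proof.
have [->//|st] := eqVneq s t.
rewrite !metropolis_offdiag//; last by rewrite eq_sym.
by rewrite !P_SRWE hamming_sym minC.
Qed.

Lemma metropolis_sum1 s : \sum_t Q s t = 1.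
Proof.
rewrite (bigD1 s)//= {1}/metropolis eqxx.
rewrite [X in _ + X](eq_bigr
  (fun u => P_SRW s u * Num.min 1 (pi u / pi s))) ?subrK// => u us.
by rewrite /metropolis eq_sym (negPf us).
Qed.

Lemma metropolis_ge0 s t : 0 <= Q s t.
Proof.
rewrite /metropolis; case: eqP => [_|_]; last first.
  by rewrite mulr_ge0 ?P_SRW_ge0// le_min ler01 divr_ge0// ltW.
rewrite subr_ge0; apply: le_trans (sum_P_SRW_le1 s).
rewrite [leRHS](bigD1 s)//= P_SRW_diag add0r.
apply: ler_sum => u _; rewrite -[leRHS]mulr1 ler_wpM2l ?P_SRW_ge0//.
by rewrite ge_min lexx.
Qed.

Lemma metropolis_dirichlet f :
  2 * dirichlet pi Q f = \sum_s \sum_t pi s * Q s t * (f s - f t) ^+ 2.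
Proof.
exact: dirichlet_sym metropolis_sum1 metropolis_reversible.
Qed.

Lemma metropolis_term_ge0 f s t : 0 <= pi s * Q s t * (f s - f t) ^+ 2.
Proof.
apply: mulr_ge0 (sqr_ge0 _); apply: mulr_ge0 (metropolis_ge0 s t).
exact: ltW.
Qed.

Lemma metropolis_dirichlet_ge0 f : 0 <= dirichlet pi Q f.
Proof.
rewrite -(pmulr_rge0 _ (ltr0Sn R 1)) metropolis_dirichlet.
apply: sumr_ge0 => s _; apply: sumr_ge0 => t _.
exact: metropolis_term_ge0.
Qed.

Variable p : R.
Hypothesis p_gt0 : 0 < p.
Hypothesis p_le : forall s, p <= pi s.

Lemma coercive_metropolis (pi1 : forall s, pi s <= 1) : coercive P_SRW Q.
Proof.
(* The uniform lower bound [p] on [pi] serves as coercivity constant: since [pi <= 1], the product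
   [p * pi s] is below both [pi s] and [pi t]. *)
exists p => // s t; have [->|st] := eqVneq s t.
  by rewrite P_SRW_diag mulr0 metropolis_ge0.
rewrite -(ler_pM2l (pi_gt0 s)) metropolis_offdiag// mulrA mulrC.
rewrite ler_wpM2l ?P_SRW_ge0// le_min ler_piMr ?(ltW (pi_gt0 s))//=; last first.
  exact: le_trans (p_le s) (pi1 s).
apply: le_trans (p_le t); rewrite ler_piMl//; exact: ltW.
Qed.

(* Any two configurations are joined by at most [N] flips, each of which
   changes [f] by at most the square root of [2 N E(f) / p]. *)
Lemma metropolis_poincare f : (0 < N)%N -> \sum_s pi s = 1 ->
  p / (2 * N%:R ^+ 3) * var pi f <= dirichlet pi Q f.
Proof.
move=> N0 pi1; set E := dirichlet pi Q f.
have N0R : 0 < N%:R :> R by rewrite ltr0n.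
have E0 : 0 <= 2 * N%:R * E / p.
  by rewrite divr_ge0 ?(ltW p_gt0)// !mulr_ge0 ?metropolis_dirichlet_ge0.
have edge s t : hamming s t = 1%N -> `|f s - f t| <= Num.sqrt (2 * N%:R * E / p).
  move=> st; rewrite -sqrtr_sqr ler_wsqrtr// ler_pdivlMr//.
  have nst : s != t by rewrite -hamming_eq0 st.
  (* All terms of the symmetrised double sum are nonnegative, so the one at [(s, t)] is at most the
     whole. *)
  have : pi s * Q s t * (f s - f t) ^+ 2 <= 2 * E.
    rewrite metropolis_dirichlet (bigD1 s)//= (bigD1 t)//= -addrA lerDl.
    by rewrite addr_ge0//; apply: sumr_ge0 => u _; rewrite ?sumr_ge0// => *;
      exact: metropolis_term_ge0.
  rewrite metropolis_offdiag// P_SRWE st eqxx.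
  rewrite -[X in X <= _]mulrA ler_pdivrMl// => dle.
  rewrite -[leRHS]mulrA [leRHS]mulrCA; apply: le_trans dle.
  by rewrite mulrC ler_wpM2r ?sqr_ge0// le_min !p_le.
have osc s t : `|f s - f t| <= N%:R * Num.sqrt (2 * N%:R * E / p).
  apply: le_trans (hamming_lipschitz edge s t) _.
  by rewrite ler_wpM2r ?sqrtr_ge0// ler_nat hamming_le.
(* Squaring the oscillation gives [N^2] times [2 N E / p], whence the factor [2 N^3]. *)
have := var_le_osc (fun s => ltW (pi_gt0 s)) pi1 osc.
rewrite exprMn sqr_sqrtr// => vle.
rewrite mulrAC ler_pdivrMr ?mulr_gt0 ?exprn_gt0// mulrC -ler_pdivlMr//.
apply: le_trans vle _; rewrite le_eqVlt; apply/orP; left; apply/eqP.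
by field; rewrite gt_eqF.
Qed.

End Metropolis.

(** * Gibbs weights and deterministic bounds on the spectral gap *)

Section Gibbs.
Context {R : realType} {N : nat}.
Variable H : cube N -> R.

Lemma card_cube : #|cube N| = (2 ^ N)%N.
Proof. by rewrite card_ffun card_bool card_ord. Qed.

Lemma uniform_cube_gt0 (s : cube N) : 0 < uniform_cube s :> R.
Proof. by rewrite invr_gt0 ltr0n card_cube expn_gt0. Qed.

Lemma sum_uniform_cube : \sum_(s : cube N) uniform_cube s = 1 :> R.
Proof.
rewrite /uniform_cube sumr_const -[_ *+ #|_|]mulr_natr mulVf//.
by rewrite pnatr_eq0 card_cube -lt0n expn_gt0.
Qed.

Lemma partition_function_gt0 : 0 < partition_function H.
Proof.
rewrite lt_neqAle eq_sym psumr_neq0; last first.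
  by move=> s _; rewrite mulr_ge0 ?expR_ge0// ltW// uniform_cube_gt0.
rewrite sumr_ge0 ?andbT; last first.
  by move=> s _; rewrite mulr_ge0 ?expR_ge0// ltW// uniform_cube_gt0.
apply/hasP; exists [ffun=> true]; first exact: mem_index_enum.
by rewrite mulr_gt0 ?expR_gt0 ?uniform_cube_gt0.
Qed.

Lemma gibbs_gt0 s : 0 < gibbs H s.
Proof.
by rewrite divr_gt0 ?partition_function_gt0// mulr_gt0 ?expR_gt0 ?uniform_cube_gt0.
Qed.

Lemma sum_gibbs : \sum_s gibbs H s = 1.
Proof. by rewrite -mulr_suml divff// gt_eqF// partition_function_gt0. Qed.

Lemma gibbs_le1 s : gibbs H s <= 1.
Proof.
rewrite -sum_gibbs (bigD1 s)//= lerDl; apply: sumr_ge0 => t _.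
exact: ltW (gibbs_gt0 t).
Qed.

(** One factor [exp(- M)] comes from the Boltzmann weight and one from the partition function, an
    average of numbers at most [exp M]. *)
Lemma gibbs_ge (M : R) : (forall s, `|H s| <= M) ->
  forall s, expR (- (2 * M)) / 2 ^+ N <= gibbs H s.
Proof.
move=> HM s; rewrite ler_pdivlMr ?partition_function_gt0//.
have Z : partition_function H <= expR M.
  rewrite -[leRHS]mulr1 -sum_uniform_cube mulr_sumr.
  apply: ler_sum => t _; rewrite ler_wpM2r ?(ltW (uniform_cube_gt0 _))//.
  by rewrite ler_expR; have := HM t; rewrite ler_norml => /andP[]; lra.
rewrite /uniform_cube card_cube natrX.
rewrite mulrAC ler_wpM2r// ?invr_ge0 ?exprn_ge0//.
apply: le_trans (_ : expR (- (2 * M)) * expR M <= _).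
  by rewrite ler_wpM2l ?expR_ge0.
rewrite -expRD ler_expR.
by have := HM s; rewrite ler_norml => /andP[]; lra.
Qed.

(** The cube is finite, so the sum of all [|H s|] bounds each of them. Coercivity therefore holds
    for every realisation of [H]. *)
Lemma gibbs_lbound : exists2 p, 0 < p & forall s, p <= gibbs H s.
Proof.
exists (expR (- (2 * \sum_s `|H s|)) / 2 ^+ N).
  by rewrite divr_gt0 ?expR_gt0 ?exprn_gt0.
apply: gibbs_ge => s; rewrite (bigD1 s)//= lerDl.
by apply: sumr_ge0.
Qed.

Lemma coercive_Q_Met_SRW : coercive P_SRW (Q_Met_SRW H).
Proof.
have [p p0 ple] := gibbs_lbound.
exact: (coercive_metropolis (@gibbs_gt0) p0 ple (@gibbs_le1)).
Qed.

Local Notation rayleigh :=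
  [set dirichlet (gibbs H) (Q_Met_SRW H) f / var (gibbs H) f |
    f in [set f | var (gibbs H) f != 0]].

(** Guards against the default value 0 of [inf] on the empty set. For [N > 0] there are two
    configurations, and the indicator of one of them is not constant. *)
Lemma rayleigh_nonempty : (0 < N)%N -> rayleigh !=set0.
Proof.
move=> N0; pose s : cube N := [ffun=> true]; pose t := flip s (Ordinal N0).
pose f : cube N -> R := fun u => (u == s)%:R.
exists (dirichlet (gibbs H) (Q_Met_SRW H) f / var (gibbs H) f); exists f => //=.
apply: (@var_neq0 _ _ _ _ s t gibbs_gt0); rewrite /f eqxx [t == s]eq_sym.
by rewrite -(hamming_eq0 s t) hamming_flip oner_eq0.
Qed.

Lemma lambda1_ge (M : R) : (0 < N)%N -> (forall s, `|H s| <= M) ->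
  expR (- (2 * M)) / (2 ^+ N * (2 * N%:R ^+ 3)) <= lambda1 H.
Proof.
move=> N0 HM; apply: lb_le_inf; first exact: rayleigh_nonempty.
move=> _ [f fv <-].
have v0 : 0 < var (gibbs H) f.
  by rewrite lt_neqAle eq_sym fv var_ge0// => s; exact: ltW (gibbs_gt0 s).
rewrite ler_pdivlMr// invfM mulrA.
apply: metropolis_poincare => //;
  [exact: gibbs_gt0| |exact: gibbs_ge|exact: sum_gibbs].
by rewrite divr_gt0 ?expR_gt0 ?exprn_gt0.
Qed.

(** Positivity allows the event on the logarithm of the gap to be rewritten as an event on the gap
    itself. *)
Lemma lambda1_gt0 : (0 < N)%N -> 0 < lambda1 H.
Proof.
move=> N0; have HM s : `|H s| <= \sum_s `|H s|.
  by rewrite (bigD1 s)//= lerDl; exact: sumr_ge0.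
apply: lt_le_trans (lambda1_ge N0 HM).
by rewrite divr_gt0 ?expR_gt0// !mulr_gt0 ?exprn_gt0 ?ltr0n.
Qed.

(* Cross-multiplied, the condition [var f != 0] becomes automatic because the
   Dirichlet form is nonnegative. *)
Lemma lambda1_ltP (a : R) : (0 < N)%N ->
  lambda1 H < a <->
  exists f, dirichlet (gibbs H) (Q_Met_SRW H) f < a * var (gibbs H) f.
Proof.
have d0 f : 0 <= dirichlet (gibbs H) (Q_Met_SRW H) f.
  exact: metropolis_dirichlet_ge0 (@gibbs_gt0) f.
have v0 f : 0 <= var (gibbs H) f.
  by apply: var_ge0 => s; exact: ltW (gibbs_gt0 s).
move=> N0; split=> [/(inf_lt (rayleigh_nonempty N0))[_ [f fv <-]] fa|[f fv]].
  by exists f; rewrite -ltr_pdivrMr// lt_neqAle eq_sym fv v0.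
(* If the variance vanished, the strict inequality would make the Dirichlet form negative. *)
have vn0 : var (gibbs H) f != 0.
  by apply: contraTneq fv => ->; rewrite mulr0 -leNgt d0.
apply: le_lt_trans
  (_ : dirichlet (gibbs H) (Q_Met_SRW H) f / var (gibbs H) f < a).
  apply: ge_inf; last by exists f.
  by exists 0 => _ [g gv <-]; exact: divr_ge0.
by rewrite ltr_pdivrMr// lt_neqAle eq_sym vn0 v0.
Qed.

End Gibbs.

(** * Measurability of the events on the spectral gap *)

Section Measurability.
Context {R : realType} {N : nat}.

Lemma cvg_mean (pi f : cube N -> R) (fn : nat -> cube N -> R) :
  (forall s, fn n s @[n --> \oo] --> f s) ->
  mean pi (fn n) @[n --> \oo] --> mean pi f.
Proof.
move=> ff; apply: cvg_big => [|s _]; first exact: add_continuous.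
by apply: cvgM; [exact: cvg_cst|exact: ff].
Qed.

Lemma cvg_var (pi f : cube N -> R) (fn : nat -> cube N -> R) :
  (forall s, fn n s @[n --> \oo] --> f s) ->
  var pi (fn n) @[n --> \oo] --> var pi f.
Proof.
move=> ff.
apply: (cvg_mean (fn := fun n s => (fn n s - mean pi (fn n)) ^+ 2)) => s.
by under eq_cvg do rewrite expr2; rewrite expr2; apply: cvgM;
  apply: cvgB; [exact: ff|exact: cvg_mean|exact: ff|exact: cvg_mean].
Qed.

Lemma cvg_dirichlet (pi f : cube N -> R) Q (fn : nat -> cube N -> R) :
  (forall s, fn n s @[n --> \oo] --> f s) ->
  dirichlet pi Q (fn n) @[n --> \oo] --> dirichlet pi Q f.
Proof.
move=> ff; apply: (cvg_mean
  (fn := fun n s => (fn n s - \sum_t Q s t * fn n t) * fn n s)) => s.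
apply: cvgM (ff s); apply: cvgB (ff s) _; exact: cvg_mean.
Qed.

Lemma cvg_rat_seq (x : R) : exists q : nat -> rat, ratr (q n) @[n --> \oo] --> x.
Proof.
have /choice[q qx] : forall n, exists q : rat, x < ratr q < x + harmonic n.
  move=> n; have /rat_in_itvoo[q] : x < x + harmonic n by rewrite ltrDl harmonic_gt0.
  by rewrite in_itv/= => ?; exists q.
exists q; apply: (@squeeze_cvgr _ _ _ _ (cst x) (fun n => x + harmonic n)).
- by near=> n; have /andP[? ?] := qx n; rewrite !ltW.
- exact: cvg_cst.
- rewrite -[X in _ --> X]addr0; apply: cvgD; [exact: cvg_cst|exact: cvg_harmonic].
Unshelve. all: by end_near. Qed.

(** The Dirichlet form and the variance are continuous in [f] and the inequality is strict, so it
    survives replacing [f] by a close rational function. Such functions form a countable type. *)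
Lemma lambda1_lt_ratP (H : cube N -> R) (a : R) : (0 < N)%N ->
  lambda1 H < a <->
  exists g : {ffun cube N -> rat},
    dirichlet (gibbs H) (Q_Met_SRW H) (ratr \o g) <
    a * var (gibbs H) (ratr \o g).
Proof.
move=> N0; rewrite lambda1_ltP//; split=> [[f fa]|[g ga]]; last first.
  by exists (ratr \o g).
have /choice[q qf] := fun s => cvg_rat_seq (f s).
pose F f := dirichlet (gibbs H) (Q_Met_SRW H) f - a * var (gibbs H) f.
have cF : F (fun s => ratr (q s n)) @[n --> \oo] --> F f.
  apply: cvgB; first exact: cvg_dirichlet.
  by apply: cvgM; [exact: cvg_cst|exact: cvg_var].
have Ff : F f < 0 by rewrite subr_lt0.
have [n _ /(_ n (leqnn n))/= Fn] := cvgr_lt _ cF _ Ff.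
exists [ffun s => q s n]; rewrite (_ : _ \o _ = fun s => ratr (q s n)); last first.
  by apply/funext => s /=; rewrite ffunE.
by rewrite -subr_lt0.
Qed.

Context {d : measure_display} {T : measurableType d}.

(** On nonnegative reals the inverse is the power [-1], also at 0, and [powR] is measurable. *)
Lemma measurable_fun_inv (f : T -> R) : (forall w, 0 <= f w) ->
  measurable_fun setT f -> measurable_fun setT (fun w => (f w)^-1).
Proof.
move=> f0 mf; rewrite (_ : (fun _ => _) = (@powR R ^~ (-1)) \o f).
  by apply: measurableT_comp mf; exact: measurable_powR.
by apply/funext => w /=; rewrite powR_inv1.
Qed.

Variable H : cube N -> T -> R.
Hypothesis mH : forall s, measurable_fun setT (H s).

Lemma measurable_gibbs s : measurable_fun setT (fun w => gibbs (H^~ w) s).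
Proof.
have mexp u : measurable_fun setT (fun w => expR (- H u w) * uniform_cube u).
  apply: measurable_funM (measurable_cst _).
  by apply: measurableT_comp => //; exact: measurable_funN.
apply: measurable_funM => //; apply: measurable_fun_inv.
  by move=> w; exact: ltW (partition_function_gt0 _).
by apply: measurable_sum => u.
Qed.

Lemma measurable_Q_Met_SRW s t :
  measurable_fun setT (fun w => Q_Met_SRW (H^~ w) s t).
Proof.
have moff u v : measurable_fun setT (fun w =>
    P_SRW u v * Num.min 1 (gibbs (H^~ w) v / gibbs (H^~ w) u)).
  apply: measurable_funM => //; apply: measurable_minr => //.
  apply: measurable_funM; first exact: measurable_gibbs.
  apply: measurable_fun_inv (measurable_gibbs u) => w.
  exact: ltW (gibbs_gt0 _ u).
rewrite /Q_Met_SRW /metropolis; case: eqP => _ //.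
apply: measurable_funB => //.
by under eq_fun do rewrite big_mkcond; apply: measurable_sum => u; case: (u != s).
Qed.

Lemma measurable_mean (f : T -> cube N -> R) :
  (forall s, measurable_fun setT (f^~ s)) ->
  measurable_fun setT (fun w => mean (gibbs (H^~ w)) (f w)).
Proof.
move=> mf; apply: measurable_sum => s.
by apply: measurable_funM (mf s); exact: measurable_gibbs.
Qed.

Lemma measurable_lambda1_lt (a : R) : (0 < N)%N ->
  measurable [set w | lambda1 (H^~ w) < a].
Proof.
move=> N0.
pose A (g : {ffun cube N -> rat}) := [set w |
  dirichlet (gibbs (H^~ w)) (Q_Met_SRW (H^~ w)) (ratr \o g) <
    a * var (gibbs (H^~ w)) (ratr \o g)].
have mA g : measurable (A g).
  rewrite -[A g]setTI; apply: measurable_fun_ltr => //.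
    apply: measurable_mean => s; apply: measurable_funM => //.
    apply: measurable_funB => //; apply: measurable_sum => t.
    by apply: measurable_funM => //; exact: measurable_Q_Met_SRW.
  apply: measurable_funM => //; apply: measurable_mean => s.
  apply: measurable_funX; apply: measurable_funB => //.
  exact: measurable_mean.
(* The countable type of rational test functions is enumerated by [unpickle]; codes of no function
   contribute the empty set. *)
rewrite (_ : [set _ | _] =
    \bigcup_n (if unpickle n is Some g then A g else set0)).
  by apply: bigcupT_measurable => n; case: unpickle.
apply/seteqP; split=> w /=.
  by move=> /(lambda1_lt_ratP _ _ N0)[g gA]; exists (pickle g) => //; rewrite pickleK.
move=> [n _]; case: unpickle => // g gA.
by apply/(lambda1_lt_ratP _ _ N0); exists g.
Qed.

End Measurability.

(** * Tail and small-ball estimates for the normal law *)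

Section NormalTail.
Context {R : realType}.
Local Notation mu := (@lebesgue_measure R).

Lemma measurable_norm_subr_ge (m r : R) : measurable [set x : R | r <= `|x - m|].
Proof.
rewrite -[X in measurable X]setTI; apply: measurable_fun_ler => //.
by apply: measurableT_comp => //; exact: measurable_funB.
Qed.

(* Doubling the variance costs a factor [sqrt 2] in the peak and leaves half
   of the exponent to be spent on the tail. *)
Lemma normal_pdf_tail (m s r x : R) : s != 0 -> 0 <= r -> r <= `|x - m| ->
  normal_pdf m s x <= Num.sqrt 2 * expR (- (r ^+ 2 / (4 * s ^+ 2))) *
    normal_pdf m (Num.sqrt 2 * s) x.
Proof.
move=> s0 r0 rx; have s2 : 0 < s ^+ 2 by rewrite exprn_even_gt0.
have t0 : Num.sqrt 2 * s != 0 by rewrite mulf_neq0// gt_eqF// sqrtr_gt0.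
have t2 : (Num.sqrt 2 * s) ^+ 2 = 2 * s ^+ 2 by rewrite exprMn sqr_sqrtr.
have peakE : normal_peak s = Num.sqrt 2 * normal_peak (Num.sqrt 2 * s).
  rewrite /normal_peak t2.
  rewrite [2 * s ^+ 2 * pi *+ 2](_ : _ = 2 * (s ^+ 2 * pi *+ 2)); last by ring.
  rewrite sqrtrM// invfM mulrA divff ?mul1r//. 
rewrite !normal_pdfE// peakE [leRHS]mulrACA.
rewrite ler_wpM2l ?mulr_ge0 ?sqrtr_ge0 ?normal_peak_ge0//.
rewrite /normal_fun t2 -expRD ler_expR.
have r2 : r ^+ 2 <= (x - m) ^+ 2.
  by rewrite -[leRHS]real_normK ?num_real// lerXn2r ?nnegrE.
rewrite -subr_ge0 (_ : _ - _ = ((x - m) ^+ 2 - r ^+ 2) / (4 * s ^+ 2)).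
  by rewrite divr_ge0 ?subr_ge0// mulr_ge0// ltW.
by field.
Qed.

(** Integrate the pointwise comparison with the wider normal density, whose total mass is 1. *)
Lemma normal_prob_tail (m s r : R) : s != 0 -> 0 <= r ->
  (normal_prob m s [set x | (r <= `|x - m|)%R] <=
   (Num.sqrt 2 * expR (- (r ^+ 2 / (4 * s ^+ 2))))%:E)%E.
Proof.
move=> s0 r0; set k := Num.sqrt 2 * _.
have k0 : 0 <= k by rewrite mulr_ge0 ?sqrtr_ge0 ?expR_ge0.
have mA := measurable_norm_subr_ge m r; set A := [set x | _] in mA *.
have mpdf u v (D : set (measurableTypeR R)) :
    measurable_fun D (fun x => (normal_pdf u v x)%:E).
  by apply/measurable_EFinP; apply: measurable_funTS; exact: measurable_normal_pdf.
apply: (@le_trans _ _ (\int[mu]_(x in A)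
    (k%:E * (normal_pdf m (Num.sqrt 2 * s) x)%:E))%E).
  apply: ge0_le_integral => //.
  - by move=> x _; rewrite lee_fin normal_pdf_ge0.
  - exact: measurable_funeM.
  - by move=> x Ax; rewrite -EFinM lee_fin; exact: normal_pdf_tail.
rewrite ge0_integralZl_EFin//; last by move=> x _; rewrite lee_fin normal_pdf_ge0.
rewrite -[leRHS]mule1 lee_wpmul2l// -(integral_normal_pdf m (Num.sqrt 2 * s)).
apply: ge0_subset_integral => //.
by move=> x _; rewrite lee_fin normal_pdf_ge0.
Qed.

(** This is [pi >= 2] inside the square root of [2 pi s^2]. *)
Lemma normal_peak_le (s : R) : s != 0 -> normal_peak s <= (2 * `|s|)^-1.
Proof.
move=> s0; rewrite lef_pV2 ?posrE; last 2 first.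
- by rewrite -invr_gt0; exact: normal_peak_gt0.
- by rewrite mulr_gt0// normr_gt0.
rewrite -[leLHS]ger0_norm ?mulr_ge0// -sqrtr_sqr ler_wsqrtr// exprMn.
rewrite real_normK ?num_real// [leRHS](_ : _ = pi * 2 * s ^+ 2); last by ring.
rewrite ler_wpM2r ?sqr_ge0// expr2 ler_wpM2r//; exact: pi_ge2.
Qed.

(** The density is at most its peak and the ball has length [2 e]. A normal law that charges a small
    ball substantially thus cannot have a large [s]. *)
Lemma normal_prob_ball (m s c e : R) : s != 0 -> 0 <= e ->
  (normal_prob m s [set x | (`|x - c| < e)%R] <= (e / `|s|)%:E)%E.
Proof.
move=> s0 e0; have -> : [set x | `|x - c| < e] = ball c e.
  by apply/seteqP; split=> x /=; rewrite /ball/= distrC.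
apply: (@le_trans _ _ (\int[mu]_(x in ball c e) (normal_peak s)%:E)%E).
  apply: ge0_le_integral => //.
  - exact: measurable_ball.
  - by move=> x _; rewrite lee_fin normal_pdf_ge0.
  - by apply/measurable_EFinP; apply: measurable_funTS; exact: measurable_normal_pdf.
  - by move=> x _; rewrite lee_fin normal_pdf_ub.
rewrite integral_cst//=; last exact: measurable_ball.
rewrite lebesgue_measure_ball// -EFinM lee_fin.
apply: le_trans (_ : (2 * `|s|)^-1 * (e *+ 2) <= _).
  by rewrite ler_wpM2r ?mulrn_wge0// normal_peak_le.
by rewrite le_eqVlt; apply/orP; left; apply/eqP; field; rewrite normr_eq0.
Qed.

End NormalTail.

(** * Gaussian tails from bounds on mean and variance *)

Section GaussianTail.
Context {d : measure_display} {T : measurableType d} {R : realType}.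
Variable P : probability T R.

(** With [q = sqrt v], Chebyshev puts mass at least [3/4] within [2 q] of the mean. The small-ball
    bound then limits [|s|], the tail bound limits the distance from [m] to the mean, and the tail
    around [m] transfers to the mean. *)
Lemma gaussian_tail (X : {RV P >-> R}) (v r : R) :
  gaussian_variable P X -> 0 < v -> 0 <= r -> ('V_P[X] <= v%:E)%E ->
  (P [set w | (14 * Num.sqrt v + r <= `|X w - fine 'E_P[X]|)%R] <=
   (Num.sqrt 2 * expR (- (r ^+ 2 / (36 * v))))%:E)%E.
Proof.
move=> [m [s law]] v0 r0 Vv; set m' := fine _; set q : R := Num.sqrt v.
have q0 : 0 < q by rewrite sqrtr_gt0.
have q20 : 0 <= 2 * q by rewrite mulr_ge0// ltW.
have q2 : q ^+ 2 = v by rewrite sqr_sqrtr// ltW.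
pose far c (t : R) := [set x : R | t <= `|x - c|].
have mfar (c t : R) : measurable (far c t) := measurable_norm_subr_ge c t.
have lawfar (c t : R) : P [set w | t <= `|X w - c|] = normal_law m s (far c t).
  by rewrite -(law _ (mfar c t)).
have cheb : (normal_law m s (far m' (2 * q)%R) <= (4^-1)%:E)%E.
  rewrite -lawfar; apply: le_trans (chebyshev _ _) _; first by rewrite mulr_gt0.
  apply: le_trans (_ : ((2 * q) ^- 2)%:E * v%:E <= _)%E.
    by rewrite lee_wpmul2l// lee_fin invr_ge0 exprn_ge0// mulr_ge0// ltW.
  rewrite -EFinM lee_fin exprMn q2 le_eqVlt; apply/orP; left; apply/eqP.
  by field; rewrite gt_eqF.
rewrite lawfar; move: cheb; rewrite /normal_law; case: eqVneq => [s0|s0].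
  (* A point mass gives a set measure 0 or 1, so Chebyshev's [1/4] forces [m] within [2 q] of the
     mean, outside the set to be estimated. *)
  rewrite !diracE; case: (boolP (m \in far m' (2 * q))) => [_|+ _].
    by rewrite lee_fin /= => le14; exfalso; move: le14; lra.
  rewrite notin_setE /= => /negP; rewrite -ltNge => mm'.
  rewrite memNset ?lee_fin ?mulr_ge0 ?sqrtr_ge0 ?expR_ge0//.
  rewrite /far/= => /le_lt_trans/(_ mm').
  by lra.
move=> cheb.
have closeE : [set x | `|x - m'| < 2 * q] = ~` far m' (2 * q).
  by apply/seteqP; split=> x /=; rewrite ltNge => /negP.
have close : ((3 / 4)%:E <= normal_prob m s [set x | (`|x - m'| < 2 * q)%R])%E.
  rewrite closeE probability_setC; last exact: mfar.
  rewrite leeBrDr; last first.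
    apply: fin_num_measure; exact: mfar.
  apply: le_trans (leeD2l _ cheb) _; rewrite -EFinD lee_fin; lra.
(* From [3/4 <= 2 q / |s|] one gets [|s| <= 8 q / 3]. The rounded value 3 turns [4 s^2] into [36 v]
   below. *)
have s_le : `|s| <= 3 * q.
  have := le_trans close (normal_prob_ball m m' s0 q20).
  rewrite lee_fin ler_pdivlMr ?normr_gt0//; lra.
have tail (t : R) : 0 <= t -> (normal_prob m s (far m t) <=
    (Num.sqrt 2 * expR (- (t ^+ 2 / (36 * v))))%:E)%E.
  move=> t0; apply: le_trans (normal_prob_tail m s0 t0) _.
  rewrite lee_fin ler_wpM2l ?sqrtr_ge0// ler_expR lerN2 ler_wpM2l ?sqr_ge0//.
  have s2 : 0 < s ^+ 2 by rewrite exprn_even_gt0.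
  have s4 : 0 < 4 * s ^+ 2 by rewrite pmulr_rgt0.
  have v36 : 0 < 36 * v by rewrite pmulr_rgt0.
  rewrite lef_pV2 ?posrE// -q2 -[s ^+ 2]real_normK ?num_real//.
  by have := normr_ge0 s; nra.
(* Otherwise the ball of radius [2 q] around the mean lies at distance at least [12 q] from [m],
   where the mass is at most [sqrt 2 * exp(- 4)] because [(12 q)^2 = 4 * 36 v]. Since [exp 4 >= 5],
   this is below [3/4]. *)
have mm' : `|m - m'| <= 14 * q.
  rewrite leNgt; apply/negP => mm'.
  suff : ((3 / 4)%:E <= (2 * expR (- 4))%:E :> \bar R)%E.
    have := expR_ge1Dx (4 : R); rewrite lee_fin expRN => e4.
    rewrite ler_pdivlMr ?expR_gt0//; lra.
  apply: le_trans close _.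
  apply: le_trans (_ : (normal_prob m s (far m (12 * q)%R) <= _)%E).
    apply: le_measure; rewrite ?inE//.
    - by rewrite closeE; apply: measurableC; exact: mfar.
    - exact: mfar.
    move=> x /= xm'; rewrite /far/=.
    by have := ler_distD x m m'; rewrite (distrC m x); lra.
  apply: le_trans (tail _ _) _; first by rewrite mulr_ge0// ltW.
  rewrite lee_fin exprMn q2 (_ : _ / _ = 4); last by field; rewrite gt_eqF.
  by rewrite ler_wpM2r ?expR_ge0// -[leRHS]ger0_norm// -sqrtr_sqr ler_wsqrtr//; lra.
apply: le_trans (tail r r0); apply: le_measure; rewrite ?inE//.
- exact: mfar.
- exact: mfar.
move=> x /=; rewrite /far/=.
by have := ler_distD m x m'; lra.
Qed.

End GaussianTail.

(** * Exponentially small probability of a small gap *)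

Section LargeDeviations.
Context {d : measure_display} {T : measurableType d} {R : realType}.
Variable P : probability T R.

Lemma natr_le_expR (n : nat) : n%:R <= expR n%:R :> R.
Proof. by apply: le_trans (expR_ge1Dx _); rewrite lerDr. Qed.

Lemma two_le_expR1 : 2 <= expR 1 :> R.
Proof. by have := expR_ge1Dx (1 : R); lra. Qed.

Lemma exp2_le_expR (N : nat) : 2 ^+ N <= expR N%:R :> R.
Proof.
rewrite -[N%:R]mulr1 expRM_natl lerXn2r ?nnegrE ?expR_ge0//.
exact: two_le_expR1.
Qed.

Lemma two_le_expR (N : nat) : (0 < N)%N -> 2 <= expR N%:R :> R.
Proof.
by move=> N0; apply: le_trans two_le_expR1 _; rewrite ler_expR ler1n.
Qed.

(** The 5 pays for the prefactor: one [exp N] each for [2^N] and for 2, and three for [N^3]. *)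
Lemma lambda1_ge_expR (N : nat) (H : cube N -> R) (M : R) : (0 < N)%N ->
  (forall s, `|H s| <= M * N%:R) ->
  expR (- ((2 * M + 5) * N%:R)) <= lambda1 H.
Proof.
move=> N0 HM; apply: le_trans (lambda1_ge N0 HM).
rewrite ler_pdivlMr; last by rewrite !mulr_gt0 ?exprn_gt0 ?ltr0n.
apply: le_trans (_ : expR (- ((2 * M + 5) * N%:R)) *
    (expR N%:R * (expR N%:R * expR N%:R ^+ 3)) <= _).
  rewrite ler_wpM2l ?expR_ge0//.
  apply: ler_pM; rewrite ?exprn_ge0 ?mulr_ge0 ?exp2_le_expR//.
  rewrite ler_pM ?exprn_ge0 ?two_le_expR//.
  by rewrite lerXn2r ?nnegrE ?expR_ge0 ?natr_le_expR.
by rewrite -expRM_natl -!expRD ler_expR; lra.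
Qed.

Lemma norm_sum_spin (N : nat) (s : cube N) :
  `|\sum_(i < N) spin R s i| <= N%:R.
Proof.
apply: le_trans (ler_norm_sum _ _ _) _.
rewrite (eq_bigr (fun=> 1)) ?sumr_const ?card_ord// => i _.
by rewrite /spin; case: ifP; rewrite ?normrN normr1.
Qed.

Lemma overlap_diag (N : nat) (s : cube N) : (0 < N)%N -> overlap R s s = 1.
Proof.
move=> N0; rewrite /overlap (eq_bigr (fun=> 1)) => [|i _].
  by rewrite sumr_const card_ord mulVf// pnatr_eq0 -lt0n.
by rewrite /spin; case: ifP; rewrite ?mulrNN mulr1.
Qed.

Lemma measure_bigsetU_le (I : Type) (r : seq I) (A : I -> set T) :
  (forall i, measurable (A i)) ->
  (P (\big[setU/set0]_(i <- r) A i) <= \sum_(i <- r) P (A i))%E.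
Proof.
move=> mA; elim: r => [|i r IH]; first by rewrite !big_nil measure0.
rewrite !big_cons; apply: le_trans (leeD2l _ IH).
by apply: measureU2 => //; exact: bigsetU_measurable.
Qed.

Variables (beta : nat -> R) (h : R).
Hypothesis h_ge0 : 0 <= h.
(** The variance of each [H s] is at most [K N]. The added 1 makes [K N >= 1], so that its square
    root is at most [K N]. *)
Let K : R := `|xi beta 1| + 1.

(** Here [25 = 14 + 11]: 14 covers the term [14 sqrt(K N)] of the Gaussian tail bound and 11 is the
    deviation [r / (K N)], while [h N] bounds the mean. *)
Lemma pspin_tail (N : nat) (H : cube N -> {RV P >-> R}) (s : cube N) :
  (0 < N)%N -> mixed_pspin beta h H ->
  (P [set w | ((25 * K + h) * N%:R <= `|H s w|)%R] <=
   (expR (- (2 * N%:R)))%:E)%E.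
Proof.
move=> N0 [gH mH cH].
have N1 : 1 <= N%:R :> R by rewrite ler1n.
have K1 : 1 <= K by rewrite lerDr.
have KN1 : 1 <= K * N%:R by rewrite mulr_ege1.
have KN0 : 0 < K * N%:R by rewrite (lt_le_trans ltr01).
(* A single coordinate is the linear combination with indicator coefficients. *)
have gHs : gaussian_variable P (H s).
  have [m [v law]] := gH (fun t => (t == s)%:R); exists m, v => B mB.
  rewrite -law//; congr (pushforward P _ B); apply/funext => w.
  rewrite (bigD1 s)//= eqxx mul1r big1 ?addr0// => t /negPf ->.
  by rewrite mul0r.
have Vv : ('V_P[H s] <= (K * N%:R)%:E)%E.
  rewrite /variance cH overlap_diag// lee_fin mulrC ler_wpM2r//.
  by rewrite (le_trans (ler_norm _))// lerDl.
have r0 : 0 <= 11 * (K * N%:R) by rewrite mulr_ge0// ltW.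
have := gaussian_tail gHs KN0 r0 Vv; rewrite mH [fine _]/=.
set m := h * _.
have m_le : `|m| <= h * N%:R.
  by rewrite normrM ger0_norm// ler_wpM2l// norm_sum_spin.
move=> tail; apply: le_trans (le_trans _ tail) _.
  apply: le_measure; rewrite ?inE.
  - rewrite -[X in measurable X]setTI; apply: measurable_fun_ler => //.
    by apply: measurableT_comp.
  - rewrite -[X in measurable X]setTI; apply: measurable_fun_ler => //.
    by apply: measurableT_comp => //; exact: measurable_funB.
  - have sq : Num.sqrt (K * N%:R) <= K * N%:R.
      rewrite -[leRHS]ger0_norm ?(ltW KN0)// -sqrtr_sqr ler_wsqrtr//.
      by rewrite expr2 ler_peMl// ltW.
    move=> w /=; have := ler_distD m (H s w) 0; rewrite !subr0; lra.
rewrite lee_fin; set e := expR (- (_ / _)).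
(* The exponent is [121 K N / 36], and [121 / 36 > 3] with [K >= 1]. One of the three units of rate
   then absorbs the factor [sqrt 2]. *)
have e_le : e <= expR (- (3 * N%:R)).
  have v36 : 0 < 36 * (K * N%:R) by rewrite pmulr_rgt0.
  rewrite ler_expR lerN2 ler_pdivlMr//.
  by rewrite exprMn; nra.
apply: le_trans (_ : 2 * expR (- (3 * N%:R)) <= _).
  rewrite ler_pM ?sqrtr_ge0 ?expR_ge0//.
  by rewrite -[leRHS]ger0_norm// -sqrtr_sqr ler_wsqrtr//; lra.
apply: le_trans (_ : expR N%:R * expR (- (3 * N%:R)) <= _).
  by rewrite ler_wpM2r ?expR_ge0// two_le_expR.
by rewrite -expRD ler_expR; lra.
Qed.

Lemma lambda1_small_prob (N : nat) (H : cube N -> {RV P >-> R}) :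
  (0 < N)%N -> mixed_pspin beta h H ->
  (P [set w | (lambda1 (fun s => H s w) <
         expR (- ((2 * (25 * K + h) + 5) * N%:R)))%R] <=
   (expR (- N%:R))%:E)%E.
Proof.
move=> N0 HH; set B := [set w | _].
pose A s := [set w | ((25 * K + h) * N%:R <= `|H s w|)%R].
have mA s : measurable (A s).
  rewrite -[A s]setTI; apply: measurable_fun_ler => //.
  by apply: measurableT_comp.
have mB : measurable B by apply: (measurable_lambda1_lt (H := H)).
(* Off the union every [|H s|] is below the threshold, and the deterministic lower bound on the gap
   applies. *)
have BA : B `<=` \big[setU/set0]_(s : cube N) A s.
  move=> w; apply: contraPP; rewrite -bigcup_seq => nA; apply/negP; rewrite -leNgt.
  apply: lambda1_ge_expR => // s; rewrite leNgt; apply/negP => Hs.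
  by apply: nA; exists s; [exact: mem_index_enum|exact: ltW].
apply: le_trans (_ : P (\big[setU/set0]_(s : cube N) A s) <= _)%E.
  by apply: le_measure; rewrite ?inE//; exact: bigsetU_measurable.
apply: le_trans (measure_bigsetU_le _ mA) _.
(* The union bound has [2^N <= exp N] terms, so one unit of the rate 2 is left. *)
apply: le_trans (_ : \sum_(s : cube N) (expR (- (2 * N%:R)))%:E <= _)%E.
  by apply: lee_sum => s _; exact: pspin_tail.
rewrite sumEFin lee_fin sumr_const card_cube -[_ *+ _]mulr_natr natrX mulrC.
apply: le_trans (_ : expR N%:R * expR (- (2 * N%:R)) <= _).
  by rewrite ler_wpM2r ?expR_ge0// exp2_le_expR.
by rewrite -expRD ler_expR; lra.
Qed.

End LargeDeviations.

(** * From probability bounds to the limsup of logarithms *)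

Lemma limn_esup_le (R : realType) (u : nat -> \bar R) (l : \bar R) :
  (\forall n \near \oo, (u n <= l)%E) -> (limn_esup u <= l)%E.
Proof.
move=> [n _ un]; rewrite /limn_esup limf_esupE.
apply: le_trans (_ : ereal_sup (u @` [set k | (n <= k)%N]) <= l)%E.
  by apply: ereal_inf_lbound; exists [set k | (n <= k)%N] => //; exists n.
by apply: ge_ereal_sup => _ [k nk <-]; exact: un.
Qed.

Lemma scaled_lne_lt (R : realType) (x y n : R) : 0 < x -> 0 < n ->
  (n^-1%:E * lne x%:E < y%:E)%E = (x < expR (y * n)).
Proof.
move=> x0 n0; rewrite lne_EFin// -EFinM lte_fin ltr_pdivrMl// mulrC.
by rewrite -[LHS]ltr_expR lnK ?posrE.
Qed.

(** Allowing [x = 0] matters: the event may have probability zero. *)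
Lemma lne_le_expR (R : realType) (x : \bar R) (y : R) :
  (0 <= x)%E -> (x <= (expR y)%:E)%E -> (lne x <= y%:E)%E.
Proof.
move=> x0 xy; apply: le_trans (_ : lne (expR y)%:E <= _)%E.
  by rewrite lee_lne// in_itv/= ?leey ?andbT// lee_fin expR_ge0.
by rewrite lne_EFin ?expR_gt0// expRK.
Qed.

Theorem corollary1p12 (R : realType) (beta : nat -> R) (h : R)
    (beta_fin : xi_finite_beyond1 beta) (h_ge0 : 0 <= h)
    (d : measure_display) (T : measurableType d) (P : probability T R)
    (H : forall N : nat, cube N -> {RV P >-> R})
    (HH : forall N : nat, (1 <= N)%N -> mixed_pspin beta h (H N)) :
  {ae P, forall w, forall N : nat, (1 <= N)%N ->
     coercive P_SRW (Q_Met_SRW (fun s : cube N => H N s w))} /\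
  exists2 c : R, 0 < c &
    (limn_esup (fun N : nat =>
       (N%:R^-1)%:E *
       lne (P [set w | (N%:R^-1)%:E *
                         lne (lambda1 (fun s : cube N => H N s w))%:E
                         < (- c)%:E])) < 0)%E.
Proof.
split; first by apply: aeW => w N _; exact: coercive_Q_Met_SRW.
exists (2 * (25 * (`|xi beta 1| + 1) + h) + 5).
  by have := normr_ge0 (xi beta 1); lra.
set c := _ + 5.
(* The event has probability at most [exp(- N)], so each term with [N >= 1] is at most [-1]. *)
apply: (@le_lt_trans _ _ (-1)%:E); last by rewrite lte_fin ltrN10.
apply: limn_esup_le; exists 1%N => // N /= N0.
have N0R : 0 < N%:R :> R by rewrite ltr0n.
rewrite (_ : [set w | _] =
    [set w | (lambda1 (fun s => H N s w) < expR (- (c * N%:R)))%R]); last first.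
  apply: eq_set => w; have l0 := lambda1_gt0 (fun s => H N s w) N0.
  by congr (is_true _); rewrite -mulNr; exact: scaled_lne_lt.
rewrite muleC lee_pdivrMr// -EFinM mulN1r.
apply: lne_le_expR => //; exact: lambda1_small_prob (HH N N0).
Qed.
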